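(* Let $I\subset J$ be $GL_m(K)$-invariant two-sided ideals of the free associative algebra $K\langle X\rangle=K\langle x_1,\ldots,x_m\rangle$ and let $\delta$ be a Weitzenböck derivation of $K\langle X\rangle$. Then the algebra of constants $(K\langle X\rangle/J)^{\delta}$ can be lifted to the algebra of constants $(K\langle X\rangle/I)^{\delta}$; that is, every element of $(K\langle X\rangle/J)^{\delta}$ is the image, under the natural homomorphism $K\langle X\rangle/I\to K\langle X\rangle/J$, of an element of $(K\langle X\rangle/I)^{\delta}$.
   Context: $K$ is a field of characteristic $0$, $m\geq 2$, and $K\langle X\rangle=K\langle x_1,\ldots,x_m\rangle$ is the free unitary associative $K$-algebra on $X=\{x_1,\ldots,x_m\}$. $V_m$ is the vector space with basis $X$. The group $GL_m(K)$ acts naturally on $V_m$ and, diagonally, on $K\langle X\rangle$: $g(x_{j_1}\cdots x_{j_n})=g(x_{j_1})\cdots g(x_{j_n})$. A derivation of an algebra is a $K$-linear operator $\delta$ with $\delta(uv)=\delta(u)v+u\delta(v)$. A Weitzenböck derivation of $K\langle X\rangle$ is a nonzero triangular linear derivation, i.e. a nonzero derivation with $\delta(V_m)\subset V_m$ and $\delta(x_j)\in \mathrm{span}_K(x_1,\ldots,x_{j-1})$ for $j=1,\ldots,m$ (so $\delta(x_1)=0$). Such a $\delta$ induces a derivation, also denoted $\delta$, on $K\langle X\rangle/I$ for every $GL_m(K)$-invariant ideal $I$. For an algebra $A$ with derivation $\delta$, $A^\delta=\ker\delta$ is the algebra of constants. *)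

(* Defs.v *)
From HB Require Import structures.
From mathcomp Require Import all_boot all_order all_algebra.
From mathcomp Require Import boolp.
From mathcomp.multinomials Require Import monalg.

Set Implicit Arguments.
Unset Strict Implicit.
Unset Printing Implicit Defensive.

Import GRing.Theory.
Local Open Scope ring_scope.
Local Open Scope quotient_scope.

(* Ideals are Prop-valued, hence not assumed decidable, and may be the whole
   algebra. *)
Record ideal (K : fieldType) (A : algType K) := Ideal {
  ideal_set :> A -> Prop;
  ideal0 : ideal_set 0;
  idealB : forall u v, ideal_set u -> ideal_set v -> ideal_set (u - v);
  idealMl : forall a u, ideal_set u -> ideal_set (a * u);
  idealMr : forall a u, ideal_set u -> ideal_set (u * a) }.

Definition ideal_pred (K : fieldType) (A : algType K) (I : ideal A) : A -> bool :=
  fun u => `[< I u >].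

Section Quotient.
Context (K : fieldType) (A : algType K).
Implicit Types I J : ideal A.

Fact ideal_zmod_closed I : zmod_closed (ideal_pred I).
Proof.
split; first exact/asboolP/ideal0.
by move=> u v /asboolP Iu /asboolP Iv; apply/asboolP/idealB.
Qed.

HB.instance Definition _ I :=
  GRing.isZmodClosed.Build A (ideal_pred I) (ideal_zmod_closed I).

Definition quot_alg I := Quotient.quot (GRing.ZmodClosed.clone A (ideal_pred I) _).

HB.instance Definition _ I := GRing.Zmodule.on (quot_alg I).
HB.instance Definition _ I := EqQuotient.on (quot_alg I).
HB.instance Definition _ I := ZmodQuotient.on (quot_alg I).

Lemma quot_algP I u v : reflect (I (u - v)) (u == v %[mod quot_alg I]).
Proof. by rewrite -Quotient.idealrBE; apply: asboolP. Qed.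

Lemma pi_eq I u v : I (u - v) -> \pi_(quot_alg I) u = \pi_(quot_alg I) v.
Proof. by move=> /quot_algP/eqP. Qed.

Lemma repr_pi I u : I (repr (\pi_(quot_alg I) u) - u).
Proof. by apply/quot_algP; rewrite reprK. Qed.

Definition qone I : quot_alg I := lift_cst (quot_alg I) 1.
Definition qmul I := lift_op2 (quot_alg I) *%R.
Definition qscale I (c : K) := lift_op1 (quot_alg I) ( *:%R c).

Lemma pi_qmul I u v :
  qmul (\pi_(quot_alg I) u) (\pi_(quot_alg I) v) = \pi_(quot_alg I) (u * v).
Proof.
rewrite /qmul; unlock; apply: pi_eq; set u' := repr _; set v' := repr _.
have -> : u' * v' - u * v = (u' - u) * v' - (- u) * (v' - v).
  by rewrite mulrBl mulNr opprK mulrBr addrA subrK.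
by apply: idealB; [apply/idealMr/repr_pi | apply/idealMl/repr_pi].
Qed.

Lemma idealZ I c u : I u -> I (c *: u).
Proof. by rewrite -mulr_algl; apply: idealMl. Qed.

Lemma pi_qscale I c u : qscale c (\pi_(quot_alg I) u) = \pi_(quot_alg I) (c *: u).
Proof.
by rewrite /qscale; unlock; apply: pi_eq; rewrite -scalerBr; apply/idealZ/repr_pi.
Qed.

Fact qmulA I : associative (@qmul I).
Proof.
by move=> x y z; rewrite -[x]reprK -[y]reprK -[z]reprK !pi_qmul mulrA.
Qed.

Fact qmul1 I : left_id (qone I) (@qmul I).
Proof. by move=> x; rewrite -[x]reprK /qone; unlock; rewrite pi_qmul mul1r. Qed.

Fact qmulr1 I : right_id (qone I) (@qmul I).
Proof. by move=> x; rewrite -[x]reprK /qone; unlock; rewrite pi_qmul mulr1. Qed.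

Fact qmulDl I : left_distributive (@qmul I) +%R.
Proof.
move=> x y z; rewrite -[x]reprK -[y]reprK -[z]reprK.
by rewrite -raddfD !pi_qmul -raddfD mulrDl.
Qed.

Fact qmulDr I : right_distributive (@qmul I) +%R.
Proof.
move=> x y z; rewrite -[x]reprK -[y]reprK -[z]reprK.
by rewrite -raddfD !pi_qmul -raddfD mulrDr.
Qed.

HB.instance Definition _ I := GRing.Zmodule_isPzRing.Build (quot_alg I)
  (@qmulA I) (@qmul1 I) (@qmulr1 I) (@qmulDl I) (@qmulDr I).

Fact qscaleA I a b (x : quot_alg I) : qscale a (qscale b x) = qscale (a * b) x.
Proof. by rewrite -[x]reprK !pi_qscale scalerA. Qed.

Fact qscale1 I : left_id 1 (@qscale I).
Proof. by move=> x; rewrite -[x]reprK pi_qscale scale1r. Qed.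

Fact qscaleDr I : right_distributive (@qscale I) +%R.
Proof.
move=> a x y; rewrite -[x]reprK -[y]reprK.
by rewrite -raddfD !pi_qscale -raddfD scalerDr.
Qed.

Fact qscaleDl I (x : quot_alg I) : {morph (@qscale I)^~ x : a b / a + b}.
Proof. by move=> a b; rewrite -[x]reprK !pi_qscale -raddfD scalerDl. Qed.

HB.instance Definition _ I := GRing.Zmodule_isLmodule.Build K (quot_alg I)
  (@qscaleA I) (@qscale1 I) (@qscaleDr I) (@qscaleDl I).

Lemma pi_monoid_morphism I : monoid_morphism (\pi_(quot_alg I)).
Proof.
by split=> [|u v]; [rewrite -[RHS]/(qone I) /qone; unlock | rewrite [RHS]pi_qmul].
Qed.

Fact pi_scalable I : scalable (\pi_(quot_alg I)).
Proof. by move=> c u; rewrite [RHS]pi_qscale. Qed.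

HB.instance Definition _ I := GRing.isScalable.Build K A (quot_alg I) *:%R
  \pi_(quot_alg I) (pi_scalable I).

(* The natural homomorphism A/I -> A/J, for I contained in J. *)
Definition quot_map I J : quot_alg I -> quot_alg J :=
  lift_fun1 (quot_alg I) \pi_(quot_alg J).

Lemma pi_quot_map I J : (forall u, I u -> J u) ->
  forall u, quot_map J (\pi_(quot_alg I) u) = \pi_(quot_alg J) u.
Proof. by move=> sIJ u; rewrite /quot_map; unlock; apply/pi_eq/sIJ/repr_pi. Qed.

(* The map induced on A/I by a map d : A -> A; it is meaningful when d is
   additive and maps I into I, by [pi_quot_der]; [weitzenbock_stable] shows that
   this holds for GL_m-invariant ideals. *)
Definition quot_der I (d : A -> A) : quot_alg I -> quot_alg I :=
  lift_op1 (quot_alg I) d.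

Lemma pi_quot_der I (d : {linear A -> A}) : (forall u, I u -> I (d u)) ->
  forall u, quot_der d (\pi_(quot_alg I) u) = \pi_(quot_alg I) (d u).
Proof.
move=> dI u; rewrite /quot_der; unlock; apply: pi_eq.
by rewrite -raddfB; apply/dI/repr_pi.
Qed.

End Quotient.

Section Derivation.
Context (A : pzRingType).

Definition leibniz (d : A -> A) := forall u v, d (u * v) = d u * v + u * d v.

Definition constants (d : A -> A) : {pred A} := [pred x | d x == 0].

End Derivation.

Definition free_alg (K : fieldType) (m : nat) := {malg K[{fmonom 'I_m}]}.

Section FreeAlgebra.
Context (K : fieldType) (m : nat).
Local Notation F := (free_alg K m).

HB.instance Definition _ := GRing.Lalgebra.on F.

Fact free_alg_scalerAr (c : K) (f g : F) : c *: (f * g) = f * (c *: g).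
Proof.
rewrite -[in RHS]mul_malgC mulrA scalerAl; congr (_ * _).
rewrite malgZ_def malgM_def fgmulgU; apply: eq_bigr => k _.
by rewrite mulm1 mulrC.
Qed.

HB.instance Definition _ := GRing.Lalgebra_isAlgebra.Build K F free_alg_scalerAr.

Definition gen (j : 'I_m) : F := << fmu j >>.

(* The linear span of the generators x_j with P j; it is V_m if P holds
   throughout. *)
Definition span_gen (P : pred 'I_m) (f : F) :=
  exists c : 'I_m -> K, f = \sum_(i | P i) c i *: gen i.

(* The action of g on V_m: its matrix in the basis x_1, ..., x_m is g, so the
   image of x_j is given by the j-th column. *)
Definition gl_gen (g : 'M[K]_m) (j : 'I_m) : F := \sum_i g i j *: gen i.

(* Its diagonal extension to words, and by linearity to the free algebra. *)
Definition gl_act (g : 'M[K]_m) : F -> F :=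
  mmap (@malgC _ K) (fun w : {fmonom 'I_m} => \prod_(j <- w) gl_gen g j).

Definition gl_invariant (I : ideal F) :=
  forall g, g \in unitmx -> forall f, I f -> I (gl_act g f).

Record weitzenbock (d : {linear F -> F}) : Prop := Weitzenbock {
  weitzenbock_leibniz : leibniz d;
  weitzenbock_neq0 : exists f, d f != 0;
  weitzenbock_linear : forall f, span_gen predT f -> span_gen predT (d f);
  weitzenbock_triangular :
    forall j : 'I_m, span_gen (fun i : 'I_m => (i < j)%N) (d (gen j)) }.

End FreeAlgebra.

Section Stable.
Context (K : fieldType) (m : nat).
Local Notation F := (free_alg K m).
Hypothesis pchar0 : [pchar K] =i pred0.

(* The coefficient of t in a polynomial expression in t that takes values in
   an ideal for all scalars t lies in that ideal. *)
Lemma ideal_coef1 (A : algType K) (I : ideal A) (e : {poly A}) :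
  (forall t : K, I e.[t%:A]) -> I e`_1.
Proof.
move=> Ie; pose n := (size e).+2.
have lt1n : (1 < n)%N by [].
pose a : 'rV[K]_n := \row_j j%:R.
have natr_inj (i j : nat) : (i < j)%N -> j%:R - i%:R != 0 :> K.
  move=> lt_ij; rewrite -natrB; last exact: ltnW.
  by rewrite ((pcharf0P K).1 pchar0) -lt0n subn_gt0.
have V_unit : Vandermonde n a \in unitmx.
  rewrite unitmxE det_Vandermonde unitfE; apply/prodf_neq0 => i _.
  by apply/prodf_neq0 => j lt_ij; rewrite !mxE natr_inj.
pose B := invmx (Vandermonde n a); pose i1 : 'I_n := Ordinal lt1n.
have -> : e`_1 = \sum_(j < n) B j i1 *: e.[(a 0 j)%:A].
  under eq_bigr do rewrite (horner_coef_wide _ (leqW (leqnSn _))) scaler_sumr.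
  rewrite exchange_big /= (bigD1 i1) //= [X in _ + X]big1 ?addr0 => [|i i_neq1].
    have /matrixP/(_ i1 i1) := mulmxV V_unit; rewrite !mxE eqxx /= mulr1n.
    rewrite -[X in _ -> X = _]scale1r => <-; rewrite scaler_suml.
    apply: eq_bigr => j _; rewrite !mxE.
    by rewrite exprZn expr1n -scalerAr mulr1 scalerA mulrC.
  have /matrixP/(_ i i1) := mulmxV V_unit; rewrite !mxE (negPf i_neq1) mulr0n.
  move=> sum0; rewrite -[RHS](scale0r e`_i) -sum0 scaler_suml.
  apply: eq_bigr => j _; rewrite !mxE.
  by rewrite exprZn expr1n -scalerAr mulr1 scalerA mulrC.
apply: big_ind => [|u v Iu Iv|j _]; first exact: ideal0.
  by rewrite -[v]opprK; apply: idealB => //; rewrite -sub0r; apply/idealB/Iv/ideal0.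
exact/idealZ/Ie.
Qed.

(* Unipotent substitutions x_j |-> x_j + t d(x_j) belong to GL_m, and the
   coefficient of t in the image of f is d(f). *)
Lemma weitzenbock_stable (I : ideal F) (d : {linear F -> F}) :
  gl_invariant I -> weitzenbock d -> forall f, I f -> I (d f).
Proof.
move=> glI [dM _ _ dT] f0 If0.
have [c cE] := choice dT.
pose g (t : K) : 'M[K]_m := \matrix_(i, j) ((i == j)%:R + t * (c j i *+ (i < j)%N)).
have gU t : g t \in unitmx.
  rewrite -unitmx_tr unitmxE det_trig; last first.
    apply/is_trig_mxP => i j lt_ij; rewrite !mxE.
    by rewrite -val_eqE /= (gtn_eqF lt_ij) ltnNge ltnW //= mulr0 addr0.
  rewrite big1 ?unitr1 // => i _.
  by rewrite !mxE eqxx ltnn mulr0 addr0.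
have g_gen t j : gl_gen (g t) j = gen K j + t *: d (gen K j).
  rewrite /gl_gen; under eq_bigr do rewrite mxE scalerDl.
  rewrite big_split /=; congr (_ + _).
    rewrite (bigD1 j) //= eqxx scale1r big1 ?addr0 // => i /negPf->.
    by rewrite scale0r.
  rewrite cE scaler_sumr [RHS]big_mkcond; apply: eq_bigr => i _.
  by case: ltnP => _; rewrite ?mulr0n ?mulr1n ?mulr0 ?scale0r // scalerA.
have d1 : d 1 = 0.
  by apply: (addrI (d 1)); rewrite addr0 -{3}[1]mulr1 dM mul1r mulr1.
pose P f := exists e : {poly F},
  [/\ e`_0 = f, e`_1 = d f & forall t, gl_act (g t) f = e.[t%:A]].
have Pword (w : {fmonom 'I_m}) k : P << k *g w >>.
  have [e [e0 e1 ew]] : exists e : {poly F}, [/\ e`_0 = << w >>, e`_1 = d << w >>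
      & forall t, \prod_(j <- w) gl_gen (g t) j = e.[t%:A]].
    case: w => s; elim: s => [|j s [e [e0 e1 es]]].
      have -> : << FMonom ([::] : seq 'I_m) >> = 1 :> F by rewrite -fmoneE.
      exists 1; rewrite !coef1 d1; split=> // t.
      by rewrite big_nil hornerC.
    have -> : << FMonom (j :: s) >> = gen K j * << FMonom s >> :> F.
      rewrite /gen /= malgM_def fgmulUU mulr1; congr << _ >>.
      by rewrite [RHS]fmmulE fmuE.
    exists (((gen K j)%:P + (d (gen K j))%:P * 'X) * e); split=> [||t].
    - by rewrite coef0M coefD coefC coefMX /= addr0 e0.
    - rewrite coefM !big_ord_recl big_ord0 /= !coefD !coefC !coefMX !coefC /=.
      by rewrite addr0 !add0r addr0 subnn subn0 e0 e1 dM addrC.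
    rewrite big_cons es hornerM_comm; last first.
      by rewrite /comm_poly mulr_algl mulr_algr.
    by rewrite hornerD hornerC hornerMX hornerC mulr_algr g_gen.
  exists (k%:A *: e); rewrite !coefZ !mulr_algl e0 e1 -linearZ /=.
  have Ek : k *: << w >> = << k *g w >> :> F.
    by apply/malgP => w'; rewrite mcoeffZ !mcoeffU mulrnAr mulr1.
  rewrite Ek; split=> // t.
  by rewrite /gl_act mmapU mul_malgC ew hornerZ mulr_algl.
have PE f : P f.
  rewrite [f]monalgE; apply: big_ind => [|u v [e [e0 e1 eu]] [e' [e0' e1' ev]]|w _].
  - by exists 0; rewrite !coef0 linear0; split=> // t; rewrite horner0 /gl_act raddf0.
  - exists (e + e'); rewrite !coefD e0 e0' e1 e1' linearD; split=> // t.
    by rewrite hornerD -eu -ev [LHS]raddfD.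
  exact: Pword.
have [e [_ <- ef]] := PE f0.
by apply: ideal_coef1 => t; rewrite -ef; apply: glI.
Qed.

Lemma pi_weitzenbock (I : ideal F) (d : {linear F -> F}) :
  gl_invariant I -> weitzenbock d ->
  forall f, quot_der d (\pi_(quot_alg I) f) = \pi_(quot_alg I) (d f).
Proof. by move=> glI dW; apply/pi_quot_der/weitzenbock_stable. Qed.

Lemma quot_der_linear (I : ideal F) (d : {linear F -> F}) :
  gl_invariant I -> weitzenbock d -> linear (quot_der (I := I) d).
Proof.
move=> glI dW a x y; rewrite -[x]reprK -[y]reprK.
by rewrite -linearP !pi_weitzenbock // -!linearP.
Qed.

Lemma quot_der_leibniz (I : ideal F) (d : {linear F -> F}) :
  gl_invariant I -> weitzenbock d -> leibniz (quot_der (I := I) d).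
Proof.
move=> glI dW x y; rewrite -[x]reprK -[y]reprK.
have piM := (pi_monoid_morphism I).2.
by rewrite -piM !pi_weitzenbock // (weitzenbock_leibniz dW) -!piM -raddfD.
Qed.

End Stable.

(* Main.v *)
Require Import Defs.
From mathcomp Require Import all_boot all_order all_algebra.
From mathcomp Require Import perm boolp.
From mathcomp.multinomials Require Import monalg.
Import GRing.Theory.
Local Open Scope ring_scope.
Set Implicit Arguments.
Unset Strict Implicit.
Unset Printing Implicit Defensive.

(** Constants modulo J lift all the way to constants of the free algebra: if
    [delta f] lies in J, then f is congruent modulo J to some y with
    [delta y = 0].  The class of y modulo I is then the required lift.

    Degree by degree the free algebra is the tensor power of V_m, on which
    delta commutes with the permutations of the tensor positions.  Choose a
    linear G with [delta G delta = delta].  Averaging the conjugates of G over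
    the symmetric group, which is possible in characteristic 0, keeps this
    identity because delta commutes with permutations
    ([symmetric_generalized_inverse]).  The element [y = f - G (delta f)] then
    satisfies [delta y = delta f - delta (G (delta f)) = 0], and it is congruent
    to f modulo J as soon as the symmetric G maps J to itself.

    That every symmetric endomorphism of a tensor power preserves J is the
    easy half of Schur-Weyl duality ([stable_symmetric]).  A symmetric
    endomorphism is a combination of symmetrised products of matrix units
    ([symmetric_span]); by polarization such a product is a combination of
    tensor powers of single matrices ([stable_symmetrized]); and the tensor
    power of g is the action of g, so it preserves J when g is invertible, and
    for arbitrary g by interpolating along the line g + t ([stable_power]).

    The same interpolation, applied to the scalar matrices t, shows that J is
    homogeneous ([ideal_homogeneous]), which justifies working one degree at a
    time. *)

(** * Polarization of products *)

Section Permanent.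
Variable (R : comPzRingType) (n : nat).

Lemma prod_natb (T : finType) (c : pred T) :
  \prod_i (c i)%:R = [forall i, c i]%:R :> R.
Proof.
case: (boolP [forall i, c i]) => [/forallP cT | /forallPn[i /negPf ci]].
  by rewrite big1 // => i _; rewrite cT.
by rewrite (bigD1 i) //= ci mul0r.
Qed.

Lemma injectiveb_onto (f : {ffun 'I_n -> 'I_n}) :
  injectiveb f = [forall k, k \in codom f].
Proof.
apply/idP/forallP => [/injectiveP f_inj k | f_onto].
  exact: inj_card_onto.
apply: (@leq_size_uniq _ (enum 'I_n)) => [|k _|]; rewrite ?enum_uniq //.
by rewrite size_codom size_enum_ord card_ord.
Qed.

(** Ryser's formula for the permanent, with subsets of the columns encoded by
    boolean functions.  Expanding the right-hand side over all maps f from rows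
    to columns, the alternating sum over the subsets containing the image of f
    vanishes unless f is onto. *)
Lemma permanent_polarization (a : 'I_n -> 'I_n -> R) :
  \sum_(s : {perm 'I_n}) \prod_i a i (s i) =
  \sum_(b : {ffun 'I_n -> bool}) (\prod_k (-1) ^+ ~~ b k) *
    \prod_i \sum_k (b k)%:R * a i k.
Proof.
under [RHS]eq_bigr => b _ do rewrite bigA_distr_bigA big_distrr /=.
rewrite exchange_big /=.
transitivity (\sum_(f : {ffun 'I_n -> 'I_n} | injectiveb f) \prod_i a i (f i)).
  rewrite [RHS](reindex (fun s : {perm 'I_n} => pval s)) /=; last first.
    exists (insubd (1%g : {perm 'I_n})) => /= f f_inj; last exact: insubdK.
    by apply: val_inj; apply: insubdK.
  apply: eq_big => [s|s _]; first by rewrite (valP s).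
  by apply: eq_bigr => i _; rewrite pvalE.
rewrite big_mkcond; apply: eq_bigr => /= f _.
under [RHS]eq_bigr => b _ do rewrite big_split /= mulrA.
rewrite -big_distrl /=.
suff -> : \sum_(b : {ffun 'I_n -> bool})
    (\prod_k (-1) ^+ ~~ b k) * \prod_i (b (f i))%:R = (injectiveb f)%:R :> R.
  by case: injectiveb; rewrite ?mul1r ?mul0r.
(* The sum over b is a product over k of the sum over the value of b at k:
   it is 1 when k is in the image of f, and 1 - 1 = 0 otherwise. *)
pose G k (c : bool) : R := (-1) ^+ (~~ c) * ((k \in codom f) ==> c)%:R.
transitivity (\sum_(b : {ffun 'I_n -> bool}) \prod_k G k (b k)).
  apply: eq_bigr => b _; rewrite /G [RHS]big_split /= !prod_natb; congr (_ * _%:R).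
  congr nat_of_bool.
  apply/forallP/forallP => [fb k | fb i]; last exact: (implyP (fb _) (codom_f f i)).
  by apply/implyP => /codomP[i ->].
rewrite -bigA_distr_bigA injectiveb_onto -prod_natb; apply: eq_bigr => k _.
rewrite big_bool /G /= implybT implybF.
by case: (k \in codom f); rewrite /= ?mulr0 ?mulr1 ?addr0 ?expr0 ?expr1 ?subrr.
Qed.

End Permanent.

(** * Linear algebra *)

Lemma generalized_inverse (K : fieldType) (T : finType) (M : T -> T -> K) :
  exists G : T -> T -> K, forall u w,
    \sum_v \sum_v' M u v * G v v' * M v' w = M u w.
Proof.
pose A := \matrix_(i < #|T|, j < #|T|) M (enum_val i) (enum_val j).
exists (fun v v' => pinvmx A (enum_rank v) (enum_rank v')) => u w.
have /matrixP/(_ (enum_rank u) (enum_rank w)) := mulmxKpV (submx_refl A).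
rewrite !mxE !enum_rankK => <-; rewrite exchange_big /=.
rewrite (reindex_onto (@enum_val T predT) enum_rank) /=; last first.
  by move=> v _; rewrite enum_rankK.
apply: eq_big => [j|j _]; first by rewrite enum_valK eqxx.
rewrite !mxE enum_rankK big_distrl /=.
rewrite (reindex_onto (@enum_val T predT) enum_rank) /=; last first.
  by move=> v _; rewrite enum_rankK.
apply: eq_big => [i|i _]; first by rewrite enum_valK eqxx.
by rewrite !mxE !enum_rankK !enum_valK.
Qed.

(** * Interpolation in an ideal *)

Section PolynomialFamily.
Variables (K : fieldType) (A : algType K) (J : ideal A).
Hypothesis pchar0 : [pchar K] =i pred0.

Lemma idealD u v : J u -> J v -> J (u + v).
Proof.
by move=> Ju Jv; rewrite -[v]opprK -[- v]sub0r; do !apply: idealB => //; apply: ideal0.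
Qed.

Lemma ideal_sum (T : Type) (r : seq T) (P : pred T) (F : T -> A) :
  (forall i, P i -> J (F i)) -> J (\sum_(i <- r | P i) F i).
Proof. by move=> JF; apply: big_ind => //; [apply: ideal0 | apply: idealD]. Qed.

(** In characteristic 0 the integers supply enough points: at most deg q of
    them are roots of q. *)
Lemma nonroots (q : {poly K}) n : q != 0 ->
  exists a : 'rV[K]_n, (forall i, q.[a 0 i] != 0) /\ Vandermonde n a \in unitmx.
Proof.
move=> q_neq0; pose s := [seq i%:R : K | i <- iota 0 (n + size q)].
pose s' := [seq x <- s | ~~ root q x].
have natr_inj : injective (fun i => i%:R : K).
  have sub_neq0 i j : (i < j)%N -> j%:R - i%:R != 0 :> K.
    move=> lt_ij; rewrite -natrB; last exact: ltnW.
    by rewrite ((pcharf0P K).1 pchar0) -lt0n subn_gt0.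
  move=> i j /= eq_ij; case: (ltngtP i j) => // /sub_neq0;
    by rewrite eq_ij subrr eqxx.
have s_uniq : uniq s by rewrite map_inj_uniq ?iota_uniq.
have s'_size : (n <= size s')%N.
  have := max_poly_roots q_neq0 (filter_all _ s) (filter_uniq _ s_uniq).
  have := count_predC (root q) s; rewrite !size_filter size_map size_iota => eq_n.
  move=> lt_q; rewrite -(leq_add2r (size q)) -eq_n addnC.
  by apply: leq_add => //; apply: ltnW.
have s'_lt (i : 'I_n) : (i < size s')%N by apply: leq_trans s'_size.
exists (\row_i s'`_i); split=> [i|].
  by have := mem_nth 0 (s'_lt i); rewrite mem_filter mxE => /andP[].
rewrite unitmxE det_Vandermonde unitfE; apply/prodf_neq0 => i _.
apply/prodf_neq0 => j lt_ij; rewrite !mxE subr_eq0 nth_uniq ?filter_uniq //.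
by rewrite gtn_eqF.
Qed.

(** Interpolation: by inverting a Vandermonde matrix, each coefficient of a
    polynomial curve is a fixed linear combination of its values at finitely many
    points, which may be chosen away from the roots of q.  The factor q excludes
    the parameters at which a matrix is singular. *)
Lemma ideal_coef_family (T : finType) (P : T -> {poly K}) (x : T -> A) (q : {poly K}) :
  q != 0 -> (forall t, q.[t] != 0 -> J (\sum_i (P i).[t] *: x i)) ->
  forall k, J (\sum_i (P i)`_k *: x i).
Proof.
move=> q_neq0 JP k; pose n := (maxn k.+1 (\max_i size (P i))).
have [a [qa aU]] := nonroots n q_neq0.
have lt_kn : (k < n)%N by apply: leq_maxl.
have szP i : (size (P i) <= n)%N.
  by apply: leq_trans (leq_maxr _ _); apply: (leq_bigmax i).
pose B := invmx (Vandermonde n a); pose k' : 'I_n := Ordinal lt_kn.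
have coefE i : (P i)`_k = \sum_(j < n) B j k' * (P i).[a 0 j].
  under eq_bigr => j _ do rewrite (horner_coef_wide _ (szP i)) big_distrr /=.
  rewrite exchange_big /=.
  transitivity (\sum_(l < n) (P i)`_l * (Vandermonde n a *m B) l k').
    rewrite mulmxV // (bigD1 k') //= mxE eqxx mulr1 big1 ?addr0 // => l.
    by move=> /negPf l_neq; rewrite mxE l_neq mulr0.
  apply: eq_bigr => l _; rewrite mxE mulr_sumr; apply: eq_bigr => j _.
  by rewrite mxE mulrA mulrC.
under eq_bigr => i _ do rewrite coefE scaler_suml.
rewrite exchange_big; apply: ideal_sum => j _ /=.
under eq_bigr => i _ do rewrite -scalerA.
by rewrite -scaler_sumr; apply/idealZ/JP.
Qed.

End PolynomialFamily.

(** * Tensor powers inside the free algebra *)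

Section Tensor.
Variables (K : fieldType) (m : nat).
Local Notation F := (free_alg K m).

Section Degree.
Variable n : nat.
Local Notation word := {ffun 'I_n -> 'I_m}.
Implicit Types (u w p q : word) (c : word -> K) (T : word -> word -> K).

Definition mon w : F := \prod_i gen K (w i).
Definition tensor c : F := \sum_w c w *: mon w.
Definition act T c : word -> K := fun u => \sum_w T u w * c w.
(** The elementary tensor of phi_1, ..., phi_n, as a matrix indexed by words. *)
Definition kron (phi : 'I_n -> 'M[K]_m) u w := \prod_i phi i (u i) (w i).

Lemma prod_linear_forms (a : 'I_n -> 'I_m -> K) :
  \prod_i \sum_k a i k *: gen K k = \sum_(u : word) (\prod_i a i (u i)) *: mon u.
Proof. by rewrite bigA_distr_bigA; apply: eq_bigr => u _; rewrite scaler_prod. Qed.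

Lemma tensor_act T c :
  tensor (act T c) = \sum_w c w *: \sum_u T u w *: mon u.
Proof.
transitivity (\sum_u \sum_w (T u w * c w) *: mon u).
  by apply: eq_bigr => u _; rewrite scaler_suml.
rewrite exchange_big; apply: eq_bigr => w _; rewrite scaler_sumr.
by apply: eq_bigr => u _; rewrite scalerA mulrC.
Qed.

Lemma eq_tensor c c' : c =1 c' -> tensor c = tensor c'.
Proof. by move=> eq_c; apply: eq_bigr => w _; rewrite eq_c. Qed.

Lemma tensorZ k c : tensor (fun w => k * c w) = k *: tensor c.
Proof.
by rewrite /tensor scaler_sumr; apply: eq_bigr => w _; rewrite scalerA.
Qed.

Lemma tensor_sum (I : finType) (z : I -> K) (c : I -> word -> K) :
  tensor (fun w => \sum_i z i * c i w) = \sum_i z i *: tensor (c i).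
Proof.
transitivity (\sum_i tensor (fun w => z i * c i w)).
  rewrite /tensor exchange_big; apply: eq_bigr => w _.
  by rewrite scaler_suml.
by apply: eq_bigr => i _; rewrite tensorZ.
Qed.

End Degree.

Lemma prod_gen (s : seq 'I_m) : \prod_(j <- s) gen K j = << FMonom s >> :> F.
Proof.
elim: s => [|j s IHs]; first by rewrite big_nil -fmoneE.
rewrite big_cons IHs /gen /= malgM_def fgmulUU mulr1; congr << _ >>.
by rewrite [LHS]fmmulE fmuE.
Qed.

Lemma scale_prod_gen (k : K) (s : seq 'I_m) :
  k *: \prod_(j <- s) gen K j = << k *g FMonom s >> :> F.
Proof.
by rewrite prod_gen; apply/malgP => w; rewrite mcoeffZ !mcoeffU mulrnAr mulr1.
Qed.

Lemma gl_act_prod_gen g (k : K) (s : seq 'I_m) :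
  gl_act g (k *: \prod_(j <- s) gen K j) = k *: \prod_(j <- s) gl_gen g j.
Proof. by rewrite scale_prod_gen /gl_act mmapU mul_malgC. Qed.

(** The word as a sequence, to match the monomials of the free algebra. *)
Definition letters n (w : {ffun 'I_n -> 'I_m}) := [tuple w i | i < n].

Lemma letters_inj n : injective (@letters n).
Proof.
move=> u w eq_uw; apply/ffunP => i.
by rewrite -[LHS](tnth_mktuple u) -[RHS](tnth_mktuple w) -/(letters u) eq_uw.
Qed.

Lemma prod_letters n (w : {ffun 'I_n -> 'I_m}) (E : 'I_m -> F) :
  \prod_(j <- letters w) E j = \prod_i E (w i).
Proof. by rewrite big_tuple; apply: eq_bigr => i _; rewrite tnth_mktuple. Qed.

Lemma gl_act_tensor n (g : 'M[K]_m) (c : {ffun 'I_n -> 'I_m} -> K) :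
  gl_act g (tensor c) = tensor (act (kron (fun=> g)) c).
Proof.
rewrite tensor_act [LHS]raddf_sum; apply: eq_bigr => w _.
rewrite -[LHS]/(gl_act g (c w *: mon w)) /mon -prod_letters gl_act_prod_gen.
by rewrite prod_letters -(prod_linear_forms (fun i k => g k (w i))).
Qed.

Lemma leibniz_prod (d : {linear F -> F}) : leibniz d -> forall n (a : 'I_n -> F),
  d (\prod_i a i) = \sum_i \prod_j (if j == i then d (a j) else a j).
Proof.
move=> dM; have d1 : d 1 = 0.
  by apply: (addrI (d 1)); rewrite addr0 -{3}[1]mulr1 dM mul1r mulr1.
elim=> [|n IHn] a; first by rewrite !big_ord0.
rewrite !big_ord_recl /= dM IHn; congr (_ + _).
rewrite big_distrr /=; apply: eq_bigr => i _.
by rewrite big_ord_recl /=.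
Qed.

(** The derivation with matrix D on V_m acts on the n-th tensor power as the sum
    over i of the product that has D in position i and the identity elsewhere. *)
Definition der_kernel n (D : 'M[K]_m) (u w : {ffun 'I_n -> 'I_m}) :=
  \sum_i kron (fun j => if j == i then D else 1%:M) u w.

Lemma derivation_tensor (d : {linear F -> F}) (D : 'M[K]_m) :
  leibniz d -> (forall j, d (gen K j) = \sum_i D i j *: gen K i) ->
  forall n (c : {ffun 'I_n -> 'I_m} -> K), d (tensor c) = tensor (act (der_kernel D) c).
Proof.
move=> dM dE n c; rewrite tensor_act linear_sum; apply: eq_bigr => w _.
rewrite linearZ /=; congr (_ *: _).
rewrite /mon (leibniz_prod dM (fun i => gen K (w i))).
transitivity (\sum_u \sum_i kron (fun j => if j == i then D else 1%:M) u w *: mon u);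
  last by apply: eq_bigr => u _; rewrite scaler_suml.
rewrite exchange_big; apply: eq_bigr => i _.
rewrite -(prod_linear_forms (fun j k => (if j == i then D else 1%:M) k (w j))).
apply: eq_bigr => j _; case: ifP => _; first exact: dE.
rewrite (bigD1 (w j)) //= mxE eqxx scale1r big1 ?addr0 // => k /negPf k_neq.
by rewrite mxE k_neq scale0r.
Qed.

Lemma homogeneous_decomposition (f : F) : exists N,
  exists c : forall n, {ffun 'I_n -> 'I_m} -> K, f = \sum_(n < N) tensor (c n).
Proof.
pose P (f : F) := exists N, exists c : forall n, {ffun 'I_n -> 'I_m} -> K,
  forall N', (N <= N')%N -> f = \sum_(n < N') tensor (c n).
(* Allowing every larger bound makes P closed under addition. *)
suff [N [c cE]] : P f by exists N, c; apply: cE.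
rewrite [f]monalgE; apply: (big_ind P) => [|u v [N [c cE]] [N' [c' cE']]|w _].
- exists 0, (fun _ _ => 0) => N' _.
  by rewrite big1 // => n _; rewrite /tensor big1 // => w _; rewrite scale0r.
- exists (maxn N N'), (fun n w => c n w + c' n w) => M; rewrite geq_max.
  move=> /andP[/cE-> /cE'->]; rewrite -big_split; apply: eq_bigr => n _ /=.
  by rewrite -big_split; apply: eq_bigr => w _; rewrite scalerDl.
case: w => s; move: (f@_ _) => k.
exists (size s).+1, (fun n w => k *+ (letters w == s :> seq _)) => N' ltN'.
rewrite (bigD1 (Ordinal ltN')) //= [X in _ + X]big1 ?addr0 => [|n n_neq]; last first.
  rewrite /tensor big1 // => w _; case: eqP => [ws|]; last by rewrite scale0r.
  by case/eqP: n_neq; apply: val_inj; rewrite -[LHS](size_tuple (letters w)) /= ws.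
pose w0 : {ffun 'I_(size s) -> 'I_m} := [ffun i => tnth (in_tuple s) i].
have w0s : letters w0 = in_tuple s.
  by apply: eq_from_tnth => i; rewrite tnth_mktuple ffunE.
rewrite /tensor (bigD1 w0) //= big1 ?addr0 => [|w w_neq].
  have /= w0E : tval (letters w0) = s by rewrite w0s.
  by rewrite w0E eqxx /mon -prod_letters w0s scale_prod_gen.
case: eqP => [ws|]; last by rewrite scale0r.
by case/eqP: w_neq; apply/letters_inj/val_inj; rewrite w0s.
Qed.

End Tensor.

(** * Operators commuting with permutations of the positions *)

Section SymmetricKernels.
Variables (K : fieldType) (m n : nat).
Local Notation word := {ffun 'I_n -> 'I_m}.

Definition permute (s : {perm 'I_n}) (u : word) : word := [ffun i => u (s i)].

Definition symmetric (T : word -> word -> K) :=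
  forall s u w, T (permute s u) (permute s w) = T u w.

Lemma permuteK s : cancel (permute s) (permute s^-1%g).
Proof. by move=> u; apply/ffunP => i; rewrite !ffunE permKV. Qed.

Lemma permute_inj s : injective (permute s).
Proof. exact: can_inj (permuteK s). Qed.

Lemma kron_permute (phi : 'I_n -> 'M[K]_m) s u w :
  kron phi (permute s u) (permute s w) = kron (fun i => phi (s^-1%g i)) u w.
Proof.
rewrite /kron [RHS](reindex_perm s); apply: eq_bigr => i _.
by rewrite !ffunE permK.
Qed.

Lemma der_kernel_symmetric D : symmetric (@der_kernel K m n D).
Proof.
move=> s u w; rewrite /der_kernel [RHS](reindex_perm s); apply: eq_bigr => i _.
rewrite kron_permute; apply: eq_bigr => j _.
by rewrite -[in LHS](inj_eq (@perm_inj _ s)) permKV.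
Qed.

Hypothesis pchar0 : [pchar K] =i pred0.

Lemma fact_neq0 : (n`!)%:R != 0 :> K.
Proof. by rewrite ((pcharf0P K).1 pchar0) -lt0n fact_gt0. Qed.

(** Average the conjugates of an arbitrary generalized inverse of M: each of them
    is a generalized inverse of the corresponding conjugate of M, which is M. *)
Lemma symmetric_generalized_inverse (M : word -> word -> K) : symmetric M ->
  exists2 G, symmetric G &
    forall c, tensor (act M (act G (act M c))) = tensor (act M c).
Proof.
move=> symM; have [G MGM] := generalized_inverse M.
pose G' u w := (n`!)%:R^-1 * \sum_s G (permute s u) (permute s w).
exists G' => [s u w|c].
  congr (_ * _); rewrite [RHS](reindex_inj (mulIg s)); apply: eq_bigr => t _.
  by congr G; apply/ffunP => i; rewrite !ffunE permM.
have MG'M u w : \sum_v \sum_v' M u v * G' v v' * M v' w = M u w.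
  transitivity ((n`!)%:R^-1 * \sum_(s : {perm 'I_n}) M u w); last first.
    by rewrite sumr_const card_Sn -[X in _ * X]mulr_natl mulKf ?fact_neq0.
  transitivity ((n`!)%:R^-1 * \sum_(s : {perm 'I_n}) \sum_v \sum_v'
      M u v * G (permute s v) (permute s v') * M v' w).
    rewrite [X in _ * X]exchange_big mulr_sumr; apply: eq_bigr => v _.
    rewrite [X in _ * X]exchange_big mulr_sumr; apply: eq_bigr => v' _.
    by rewrite /G' -mulr_suml -mulr_sumr mulrCA !mulrA.
  congr (_ * _); apply: eq_bigr => s _; rewrite -(symM s) -MGM.
  rewrite [RHS](reindex_inj (@permute_inj s)); apply: eq_bigr => v _.
  rewrite [RHS](reindex_inj (@permute_inj s)); apply: eq_bigr => v' _.
  by rewrite !symM.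
apply: eq_tensor => u; rewrite /act.
transitivity (\sum_w (\sum_v \sum_v' M u v * G' v v' * M v' w) * c w); last first.
  by apply: eq_bigr => w _; rewrite MG'M.
under [RHS]eq_bigr => w _ do rewrite mulr_suml.
rewrite [RHS]exchange_big; apply: eq_bigr => v _; rewrite mulr_sumr.
under [RHS]eq_bigr => w _ do rewrite mulr_suml.
rewrite [RHS]exchange_big; apply: eq_bigr => v' _; rewrite !mulr_sumr.
by apply: eq_bigr => w _; rewrite !mulrA.
Qed.

(** Average the expansion of T into the matrix units of the tensor power, each of
    which is an elementary tensor of matrix units of size m. *)
Lemma symmetric_span (T : word -> word -> K) u w : symmetric T ->
  T u w = \sum_(pq : word * word) (n`!)%:R^-1 * T pq.1 pq.2 *
    \sum_(s : {perm 'I_n}) \prod_i delta_mx (pq.1 (s i)) (pq.2 (s i)) (u i) (w i).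
Proof.
move=> symT.
transitivity ((n`!)%:R^-1 * \sum_(s : {perm 'I_n}) T (permute s^-1 u) (permute s^-1 w)).
  under eq_bigr => s _ do rewrite symT.
  by rewrite sumr_const card_Sn -[X in _ * X]mulr_natl mulKf ?fact_neq0.
under [RHS]eq_bigr => pq _ do rewrite -mulrA mulr_sumr.
rewrite -mulr_sumr exchange_big; congr (_ * _); apply: eq_bigr => s _.
rewrite (bigD1 (permute s^-1 u, permute s^-1 w)) //= [X in _ = _ + X]big1 ?addr0.
  by rewrite big1 ?mulr1 // => i _; rewrite mxE !ffunE !permK !eqxx.
move=> [p q] /= /negPf pq_neq.
under eq_bigr => i _ do rewrite mxE.
rewrite prod_natb; case: forallP => [puqw|]; last by rewrite mulr0.
case/eqP: pq_neq; congr (_, _); apply/ffunP => i; rewrite ffunE;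
  by have /andP[/eqP uE /eqP wE] := puqw (s^-1%g i); rewrite ?uE ?wE permKV.
Qed.

End SymmetricKernels.

(** * Symmetric operators preserve invariant ideals *)

Section InvariantIdeals.
Variables (K : fieldType) (m : nat).
Local Notation F := (free_alg K m).
Variable J : ideal F.
Hypotheses (pchar0 : [pchar K] =i pred0) (glJ : gl_invariant J).

Lemma horner_char_poly (g : 'M[K]_m) t : (char_poly g).[t] = \det (t%:M - g).
Proof.
rewrite -horner_evalE /char_poly -det_map_mx; congr (\det _).
by apply/matrixP => i j; rewrite !mxE /= horner_evalE !hornerE hornerMn hornerX.
Qed.

(** The scalar matrix t multiplies degree n by t^n, so the homogeneous
    components are the coefficients of a polynomial in t with values in J. *)
Lemma ideal_homogeneous N (c : forall n, {ffun 'I_n -> 'I_m} -> K) :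
  J (\sum_(n < N) tensor (c n)) -> forall n, (n < N)%N -> J (tensor (c n)).
Proof.
move=> Jc n ltn.
have scal t k : tensor (act (kron (fun=> t%:M)) (c k)) = t ^+ k *: tensor (c k).
  rewrite -tensorZ; apply: eq_tensor => u.
  rewrite /act (bigD1 u) //= /kron [X in _ + X]big1 ?addr0 => [|w w_neq].
    under eq_bigr => i _ do rewrite mxE eqxx.
    by rewrite prodr_const card_ord.
  suff /existsP[i /negPf ui] : [exists i, u i != w i].
    by rewrite (bigD1 i) //= mxE ui !mul0r.
  apply: contraR w_neq; rewrite negb_exists => /forallP uw.
  by apply/eqP/ffunP => i; apply/esym/eqP; rewrite -[_ == _]negbK.
have Jcoef : J (\sum_(k < N) ('X^k : {poly K})`_n *: tensor (c k)).
  apply: (ideal_coef_family pchar0 (negbT (polyX_eq0 K))) => t.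
  rewrite hornerX => t_neq0.
  have : J (gl_act t%:M (\sum_(n < N) tensor (c n))).
    by apply: glJ => //; rewrite unitmxE det_scalar unitrX ?unitfE.
  rewrite /gl_act raddf_sum; congr (J _); apply: eq_bigr => k _.
  by rewrite -[LHS]/(gl_act _ _) gl_act_tensor scal hornerXn.
move: Jcoef; rewrite (bigD1 (Ordinal ltn)) //= [X in J (_ + X)]big1 => [|k k_neq].
  by rewrite addr0 coefXn eqxx scale1r.
rewrite coefXn; case: eqP => [nk|]; last by rewrite scale0r.
by case/eqP: k_neq; apply: val_inj.
Qed.

Section Stable.
Variable n : nat.
Local Notation word := {ffun 'I_n -> 'I_m}.

Definition stable (T : word -> word -> K) :=
  forall c, J (tensor c) -> J (tensor (act T c)).

Lemma stable_comb (I : finType) (z : I -> K) (T : I -> word -> word -> K) T' :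
  (forall i, stable (T i)) -> (forall u w, T' u w = \sum_i z i * T i u w) ->
  stable T'.
Proof.
move=> stT T'E c Jc.
have -> : tensor (act T' c) = \sum_i z i *: tensor (act (T i) c).
  rewrite -tensor_sum; apply: eq_tensor => u; rewrite /act.
  under [RHS]eq_bigr => i _ do rewrite mulr_sumr.
  rewrite exchange_big; apply: eq_bigr => w _.
  by rewrite T'E mulr_suml; apply: eq_bigr => i _; rewrite mulrA.
by apply: ideal_sum => i _; apply/idealZ/stT.
Qed.

(** For singular g, consider g + t, which is invertible unless t is a root of
    the characteristic polynomial of -g, and take the constant term in t. *)
Lemma stable_power (g : 'M[K]_m) : stable (kron (fun=> g)).
Proof.
move=> c Jc.
pose P (u : word) : {poly K} := \sum_(w : word)
  (\prod_i ((g (u i) (w i))%:P + 'X *+ (u i == w i))) * (c w)%:P.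
have PE t u : (P u).[t] = act (kron (fun=> g + t%:M)) c u.
  rewrite horner_sum; apply: eq_bigr => w _.
  rewrite hornerM hornerC horner_prod; congr (_ * _); apply: eq_bigr => i _.
  by rewrite hornerD hornerC hornerMn hornerX !mxE.
have -> : tensor (act (kron (fun=> g)) c) = tensor (fun u => (P u)`_0).
  apply: eq_tensor => u; rewrite -horner_coef0 PE.
  apply: eq_bigr => w _; congr (_ * _); apply: eq_bigr => i _.
  by rewrite !mxE mul0rn addr0.
have q_neq0 := monic_neq0 (char_poly_monic (- g)).
apply: (ideal_coef_family pchar0 q_neq0) => t.
rewrite horner_char_poly opprK addrC => det_neq0.
have -> : \sum_u (P u).[t] *: mon K u = gl_act (g + t%:M) (tensor c).
  by rewrite gl_act_tensor; apply: eq_bigr => u _; rewrite PE.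
by apply: glJ => //; rewrite unitmxE unitfE.
Qed.

(** Polarization writes the symmetrised product as a signed sum, over the
    subsets b of the positions, of the tensor powers of the partial sums of phi. *)
Lemma stable_symmetrized (phi : 'I_n -> 'M[K]_m) :
  stable (fun u w : word => \sum_(s : {perm 'I_n}) \prod_i phi (s i) (u i) (w i)).
Proof.
apply: (@stable_comb _ (fun b : {ffun 'I_n -> bool} => \prod_k (-1) ^+ ~~ b k)
  (fun b => kron (fun=> \sum_k (b k)%:R *: phi k))) => [b|u w].
  exact: stable_power.
rewrite (permanent_polarization (fun i k => phi k (u i) (w i))).
apply: eq_bigr => b _; congr (_ * _); apply: eq_bigr => i _.
by rewrite summxE; apply: eq_bigr => k _; rewrite mxE.
Qed.

Lemma stable_symmetric (T : word -> word -> K) : symmetric T -> stable T.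
Proof.
move=> symT.
by apply: stable_comb (fun u w => symmetric_span pchar0 u w symT) => pq;
  apply: (stable_symmetrized (fun k => delta_mx (pq.1 k) (pq.2 k))).
Qed.

End Stable.

(** * Lifting constants *)

Section Derivation.
Variables (d : {linear F -> F}) (D : 'M[K]_m).
Hypotheses (dM : leibniz d) (dE : forall j, d (gen K j) = \sum_i D i j *: gen K i).

(** With G a symmetric generalized inverse of d, take z = G (d c). *)
Lemma derivation_lift_homogeneous n (c : {ffun 'I_n -> 'I_m} -> K) :
  J (d (tensor c)) -> exists z, d z = d (tensor c) /\ J z.
Proof.
have dT := derivation_tensor dM dE; rewrite dT => Jdc.
have [G symG DGD] := symmetric_generalized_inverse pchar0 (@der_kernel_symmetric K m n D).
exists (tensor (act G (act (der_kernel D) c))); split; last exact: stable_symmetric.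
by rewrite (dT n (act G _)) DGD.
Qed.

Lemma derivation_lift f : J (d f) -> exists2 y, d y = 0 & J (y - f).
Proof.
have [N [c ->]] := homogeneous_decomposition f; rewrite linear_sum => Jd.
have dT := derivation_tensor dM dE.
have Jdc (n : 'I_N) : J (d (tensor (c n))).
  rewrite dT; apply: (ideal_homogeneous (c := fun n => act (der_kernel D) (c n)) _ (ltn_ord n)).
  by under eq_bigr => k _ do rewrite -dT.
have [z zP] := choice (fun n => derivation_lift_homogeneous (Jdc n)).
have dz : d (\sum_n z n) = d (\sum_(n < N) tensor (c n)).
  by rewrite !linear_sum; apply: eq_bigr => n _; rewrite (zP n).1.
exists (\sum_(n < N) tensor (c n) - \sum_n z n); first by rewrite linearB dz subrr.
rewrite addrC addrA addNr sub0r -[X in J X]sub0r; apply: idealB; first exact: ideal0.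
by apply: ideal_sum => n _; have [] := zP n.
Qed.

End Derivation.

End InvariantIdeals.

Unset Implicit Arguments.

Theorem corollary4p3 (K : fieldType) (m : nat)
    (I J : ideal (free_alg K m))
    (delta : {linear free_alg K m -> free_alg K m}) :
  [pchar K] =i pred0 -> (2 <= m)%N ->
  gl_invariant I -> gl_invariant J -> (forall f, I f -> J f) ->
  weitzenbock delta ->
  forall x : quot_alg J, x \in constants (quot_der (I := J) delta) ->
  exists2 y : quot_alg I,
    y \in constants (quot_der (I := I) delta) & quot_map J y = x.
Proof.
move=> pchar0 _ glI glJ sIJ dW x; rewrite inE -[x]reprK; set f := repr x.
rewrite pi_weitzenbock // -(raddf0 (\pi_(quot_alg J))%qT) => /quot_algP; rewrite subr0 => Jdf.
have dlin j : exists c, delta (gen K j) = \sum_i c i *: gen K i.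
  apply: (weitzenbock_linear dW); exists (fun i => (i == j)%:R).
  rewrite (bigD1 j) //= eqxx scale1r big1 ?addr0 // => i /negPf->.
  by rewrite scale0r.
have [D DE] := choice dlin.
have dE j : delta (gen K j) = \sum_i (\matrix_(i, j) D j i) i j *: gen K i.
  by rewrite DE; apply: eq_bigr => i _; rewrite mxE.
have [y dy0 Jyf] := derivation_lift pchar0 glJ (weitzenbock_leibniz dW) dE Jdf.
exists (\pi_(quot_alg I) y)%qT; last by rewrite pi_quot_map //; apply: pi_eq.
by rewrite inE pi_weitzenbock // dy0 raddf0.
Qed.
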